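(* Let $k$ be a field, let $\mathbf{V}$ be a separative variety of $k$-algebras, and let $A\in\mathbf{V}$ be an inverse limit of finite-dimensional $k$-algebras (not necessarily associative). Suppose that $A$ has a finitely generated subalgebra $S$ which is dense in the inverse limit topology on $A$. Then: (i) For all $n>0$, the ideal $A_{(n)}$ is open in the inverse limit topology on $A$. (ii) Every $k$-algebra homomorphism of $A$ into a nilpotent $k$-algebra $B$ is continuous (with respect to the inverse limit topology on $A$ and the discrete topology on $B$). (iii) If the finite-dimensional algebras of which $A$ is obtained as an inverse limit are all nilpotent, then every $k$-algebra homomorphism from $A$ to a finite-dimensional $k$-algebra $B$ is continuous (with respect to the inverse limit topology on $A$ and the discrete topology on $B$).
   Context: Algebras: $k$ is a field, and a $k$-algebra is a $k$-vector space with a $k$-bilinear multiplication, not assumed associative, commutative or unital. Inverse limits are taken over inversely directed systems of algebras and algebra homomorphisms; the inverse limit topology on $A=\varprojlim_i A_i$ is the inverse limit of the discrete topologies on the $A_i$. Nilpotence: for subspaces $B,C$ of an algebra $A$, $BC$ denotes the $k$-subspace spanned by all products $bc$ ($b\in B$, $c\in C$). Define recursively $A_{(1)}=A$ and $A_{(n+1)}=\sum_{0<m<n+1}A_{(m)}A_{(n+1-m)}$. These are ideals of $A$ forming a decreasing chain. $A$ is nilpotent if $A_{(n)}=\{0\}$ for some $n\ge 1$. Varieties and monomials: a variety of $k$-algebras is the class of all $k$-algebras satisfying a fixed set of identities. A monomial is a nonempty bracketed product of indeterminates (repetitions allowed); its length (or degree) is its length as a string of letters, ignoring parentheses. Every monomial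 $w$ of length $>1$ is uniquely a product $w=w'w''$ of two monomials; the submonomials of $w$ are $w$ itself and, if $\mathrm{length}(w)>1$, the submonomials of $w'$ and of $w''$. An identity says that a $k$-linear combination of monomials evaluates to zero; it is homogeneous if all the monomials in it have the same number of occurrences of each variable. Separating monomials: for a natural number $m$, a monomial $w$ is $m$-separating if it has a submonomial of length exactly $\mathrm{length}(w)-m$. For natural numbers $n\le N$, $w$ is $[n,N]$-separating if it is $m$-separating for some $m\in\{n,n+1,\dots,N\}$. Separative varieties: for a natural number $d$ (with $d=0$ allowed), a variety $\mathbf{V}$ of $k$-algebras is $[1,1+d]$-separative if every monomial of degree $>1$ is congruent modulo homogeneous identities of $\mathbf{V}$ to a $k$-linear combination of $[1,1+d]$-separating monomials. $\mathbf{V}$ is separative if it is $[1,1+d]$-separative for some natural number $d$. *)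

(* Defs.v *)
From HB Require Import structures.
From mathcomp Require Import all_boot all_order all_algebra.
From mathcomp Require Import finmap.
From mathcomp Require Import all_classical.
From mathcomp Require Import topology.
From mathcomp Require Import monalg.
From mathcomp Require Import sesquilinear.

Set Implicit Arguments.
Unset Strict Implicit.
Unset Printing Implicit Defensive.

Import Order.TTheory GRing.Theory.

Local Open Scope classical_set_scope.
Local Open Scope ring_scope.

(* A [k]-algebra: no associativity, commutativity or unit is assumed. *)
HB.mixin Record Lmodule_isNAAlgebra (k : fieldType) A of GRing.Lmodule k A := {
  namul : A -> A -> A;
  namul_bilinear : bilinear_for *:%R *:%R namul
}.

#[short(type="naAlgType")]
HB.structure Definition NAAlgebra (k : fieldType) :=
  {A of GRing.Lmodule k A & Lmodule_isNAAlgebra k A}.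

Reserved Notation "x ** y" (at level 40, left associativity).
Notation "x ** y" := (namul x y) : ring_scope.

HB.instance Definition _ (k : fieldType) (A : naAlgType k) :=
  bilinear_isBilinear.Build k A A A *:%R *:%R (@namul k A) namul_bilinear.

Definition alg_hom (k : fieldType) (A B : naAlgType k) (f : A -> B) : Prop :=
  linear f /\ {morph f : x y / x ** y}.

Definition finite_dim (k : fieldType) (V : lmodType k) : Prop :=
  exists n, inhabited (Vector.axiom n V).

Definition subspace_span (k : fieldType) (V : lmodType k) (X : set V) : set V :=
  smallest [set W | submod_closed [in W]] X.

Section Subalgebras.
Variables (k : fieldType) (A : naAlgType k).

Definition is_subalgebra (S : set A) : Prop :=
  submod_closed [in S] /\ (forall x y, S x -> S y -> S (x ** y)).

Definition finitely_generated (S : set A) : Prop :=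
  exists2 X : set A, finite_set X & S = smallest is_subalgebra X.

Definition mul_subspaces (B C : set A) : set A :=
  subspace_span [set x | exists b c, [/\ B b, C c & x = b ** c]].

(* [npow_upto N n] is $A_{(n)}$ as soon as [n <= N.+1]; the bound [N] only
   serves to make the recursion structural. The sum of a family of subspaces
   is the span of its union. *)
Fixpoint npow_upto (N n : nat) : set A :=
  if N is N'.+1 then
    if (n <= 1)%N then [set: A]
    else subspace_span
      (\bigcup_(m in [set m | (0 < m < n)%N])
         mul_subspaces (npow_upto N' m) (npow_upto N' (n - m)))
  else [set: A].

(* Only meaningful for [0 < n]; see [npow1] and [npowS]. *)
Definition npow (n : nat) : set A := npow_upto n n.

Lemma npow_upto_indep n N M :
  (n <= N.+1)%N -> (n <= M.+1)%N -> npow_upto N n = npow_upto M n.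
Proof.
elim/ltn_ind: n N M => n IHn [|N] [|M] nN nM //=; rewrite ?nN ?nM //.
case: ifP => // /negbT; rewrite -ltnNge => n_gt1; congr subspace_span.
apply: eq_bigcupr => i /andP[i0 ilt].
have iN K : (n <= K.+2)%N -> (i <= K.+1)%N by move=> nK; apply: leq_trans ilt nK.
have subK K : (n <= K.+2)%N -> (n - i <= K.+1)%N.
  by move=> nK; rewrite leq_subLR (leq_trans nK)// -[K.+2]add1n leq_add2r.
congr mul_subspaces; apply: IHn; rewrite ?iN ?subK//.
by rewrite ltn_subrL i0 (leq_trans _ ilt).
Qed.

Lemma npow_upto_stable N n : (n <= N.+1)%N -> npow_upto N n = npow n.
Proof. by move=> nN; apply: npow_upto_indep. Qed.

Lemma npow1 : npow 1 = [set: A].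
Proof. by []. Qed.

Lemma npowS n : (0 < n)%N ->
  npow n.+1 = subspace_span
    (\bigcup_(m in [set m | (0 < m < n.+1)%N])
       mul_subspaces (npow m) (npow (n.+1 - m))).
Proof.
case: n => // n _.
transitivity (subspace_span (\bigcup_(m in [set m | (0 < m < n.+2)%N])
  mul_subspaces (npow_upto n.+1 m) (npow_upto n.+1 (n.+2 - m)))) => //.
congr subspace_span; apply: eq_bigcupr => i /andP[i0 ilt].
by rewrite !npow_upto_stable// ?leq_subr// ltnW.
Qed.

Definition nilpotent_alg : Prop := exists2 n, (0 < n)%N & npow n = [set 0].

End Subalgebras.

(* Monomials: binary trees with leaves in a countable set of indeterminates. *)
Inductive monomial : Type := MVar of nat | MMul of monomial & monomial.

Fixpoint monomial_to_tree (w : monomial) : GenTree.tree nat :=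
  match w with
  | MVar i => GenTree.Leaf i
  | MMul u v => GenTree.Node 0 [:: monomial_to_tree u; monomial_to_tree v]
  end.

Fixpoint tree_to_monomial (t : GenTree.tree nat) : option monomial :=
  match t with
  | GenTree.Leaf i => Some (MVar i)
  | GenTree.Node 0 [:: t1; t2] =>
      if (tree_to_monomial t1, tree_to_monomial t2) is (Some u, Some v)
      then Some (MMul u v) else None
  | _ => None
  end.

Lemma monomial_to_treeK : pcancel monomial_to_tree tree_to_monomial.
Proof. by elim=> //= u -> v ->. Qed.

HB.instance Definition _ :=
  Countable.copy monomial (pcan_type monomial_to_treeK).

Fixpoint mlength (w : monomial) : nat :=
  match w with
  | MVar _ => 1
  | MMul u v => mlength u + mlength v
  end.

Fixpoint occurrences (i : nat) (w : monomial) : nat :=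
  match w with
  | MVar j => (i == j)
  | MMul u v => occurrences i u + occurrences i v
  end.

Fixpoint submonomials (w : monomial) : seq monomial :=
  w :: match w with
       | MVar _ => [::]
       | MMul u v => submonomials u ++ submonomials v
       end.

(* The equation is additive because subtraction on [nat] is truncated. *)
Definition separating (m : nat) (w : monomial) : Prop :=
  exists2 u, u \in submonomials w & (mlength u + m = mlength w)%N.

Definition interval_separating (n N : nat) (w : monomial) : Prop :=
  exists2 m, (n <= m <= N)%N & separating m w.

Section Varieties.
Variable k : fieldType.

Fixpoint eval_monomial (A : naAlgType k) (e : nat -> A) (w : monomial) : A :=
  match w with
  | MVar i => e i
  | MMul u v => eval_monomial e u ** eval_monomial e v
  end.

(* A linear combination [p] of monomials stands for the identity [p = 0]. *)
Definition satisfies (A : naAlgType k) (p : {malg k[monomial]}) : Prop :=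
  forall e : nat -> A, \sum_(w <- msupp p) p@_w *: eval_monomial e w = 0.

Definition homogeneous (p : {malg k[monomial]}) : Prop :=
  forall u v, u \in msupp p -> v \in msupp p ->
  forall i, occurrences i u = occurrences i v.

Definition is_variety (V : set (naAlgType k)) : Prop :=
  exists E : set {malg k[monomial]},
    V = [set A | forall p, E p -> satisfies A p].

Definition identity_of (V : set (naAlgType k)) (p : {malg k[monomial]}) : Prop :=
  forall A, V A -> satisfies A p.

(* The difference lies in the span of the homogeneous identities of [V]. *)
Definition congruent_mod_homogeneous (V : set (naAlgType k))
    (p q : {malg k[monomial]}) : Prop :=
  subspace_span [set h | homogeneous h /\ identity_of V h] (p - q).

Definition interval_separative (d : nat) (V : set (naAlgType k)) : Prop :=
  forall w : monomial, (1 < mlength w)%N ->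
  exists2 p : {malg k[monomial]},
    (forall u, u \in msupp p -> interval_separating 1 (1 + d) u) &
    congruent_mod_homogeneous V << w >> p.

Definition separative (V : set (naAlgType k)) : Prop :=
  exists d, interval_separative d V.

End Varieties.

(* An inversely directed system: indices are directed downwards, and there is
   a transition map [obj i -> obj j] whenever [i <= j]. *)
Record inv_system (k : fieldType) := InvSystem {
  ix_disp : Order.disp_t;
  ix : porderType ix_disp;
  obj : ix -> naAlgType k;
  tr : forall i j : ix, (i <= j)%O -> obj i -> obj j;
  ix_inhabited : inhabited ix;
  ix_directed : forall i j : ix, exists l : ix, (l <= i)%O /\ (l <= j)%O;
  tr_hom : forall (i j : ix) (hij : (i <= j)%O), alg_hom (tr hij);
  tr_id : forall (i : ix) (hii : (i <= i)%O) (x : obj i), tr hii x = x;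
  tr_comp : forall (i j l : ix) (hij : (i <= j)%O) (hjl : (j <= l)%O)
    (hil : (i <= l)%O) (x : obj i), tr hjl (tr hij x) = tr hil x
}.

Section InverseLimits.
Variables (k : fieldType) (D : inv_system k) (A : naAlgType k).
Variable pi : forall i : ix D, A -> obj i.

(* [A], with projections [pi], is the inverse limit of [D]: [pi] identifies [A]
   with the subalgebra of compatible families of the product of the [obj i]. *)
Definition is_inverse_limit : Prop :=
  (forall i, alg_hom (pi i)) /\
  set_bij [set: A]
    [set x : forall i : ix D, obj i |
      forall (i j : ix D) (hij : (i <= j)%O), tr hij (x i) = x j]
    (fun a i => pi i a).

Definition inverse_limit_topology : topologicalType :=
  initial_topology
    (fun a : A => (fun i => pi i a)
       : prod_topology (fun i : ix D => discrete_topology (obj i))).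

End InverseLimits.

(* Main.v *)
(* If [S] is generated by a finite set, separativity writes every monomial of
   degree [> n] in the generators as a combination of values [f s], [s] in [S],
   where [f] runs over the finitely many compositions of multiplications by
   monomials of total degree between [n] and [n + d]. An inverse limit of
   finite-dimensional spaces is linearly compact, so the sum of the images
   [f A] is closed; it lies in [A_(n+1)], and it is of finite codimension since
   it contains all but finitely many monomials, so it is open.

   For (iii), it suffices that [f] kills some [A_(n)]. Otherwise the [f A_(n)]
   stabilize at a nonzero [J] with [J = f(A) J + J f(A)], so that a basis [c] of
   [J] satisfies [c = T c] for a matrix [T] of sums of left and right
   multiplications. Lifted to the pro-nilpotent [A], [id - T] becomes
   invertible, hence it is surjective on [f(A)^r], and by finite dimension
   injective: [c = 0]. *)
Require Import Defs.
From HB Require Import structures.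
From mathcomp Require Import all_boot all_order all_algebra.
From mathcomp Require Import all_classical.
From mathcomp Require Import topology.
From mathcomp Require Import finmap monalg.

Set Implicit Arguments.
Unset Strict Implicit.
Unset Printing Implicit Defensive.

Import GRing.Theory.

Local Open Scope classical_set_scope.
Local Open Scope ring_scope.

(** * Subspaces as predicates: spans, images and preimages *)

Section Submodules.
Variables (k : fieldType) (V : lmodType k).
Implicit Types (W X : set V) (x y : V).

(** A form of [submod_closed] on bare sets, free of the boolean membership [[in W]]. *)
Definition submodule W : Prop :=
  W 0 /\ forall a x y, W x -> W y -> W (a *: x + y).

Lemma submod_closedP W : submod_closed [in W] <-> submodule W.
Proof.
split=> -[W0 WL]; split.
- exact: set_mem W0.
- by move=> a x y Wx Wy; apply/set_mem/WL; apply/mem_set.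
- exact: mem_set.
- by move=> a x y /set_mem Wx /set_mem Wy; apply/mem_set/WL.
Qed.

Lemma submoduleZ W a x : submodule W -> W x -> W (a *: x).
Proof. by move=> [W0 WL] Wx; rewrite -[_ *: _]addr0; apply: WL. Qed.

Lemma submoduleD W x y : submodule W -> W x -> W y -> W (x + y).
Proof. by move=> [W0 WL] Wx Wy; rewrite -[x]scale1r; apply: WL. Qed.

Lemma submoduleB W x y : submodule W -> W x -> W y -> W (x - y).
Proof.
move=> sW Wx Wy; apply: submoduleD => //.
by rewrite -scaleN1r; apply: submoduleZ.
Qed.

Lemma submodule_sum W (I : Type) (r : seq I) (P : pred I) (F : I -> V) :
  submodule W -> (forall i, P i -> W (F i)) -> W (\sum_(i <- r | P i) F i).
Proof.
move=> sW WF; apply: (big_ind W) => //; first by case: sW.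
by move=> x y; apply: submoduleD.
Qed.

Lemma submodule_span X : submodule (subspace_span X).
Proof.
split=> [W /= [/submod_closedP[]]//|a x y Xx Xy W /= [sW XW]].
by have /submod_closedP[_] := sW; apply; [apply: Xx|apply: Xy].
Qed.

Lemma subset_span X : X `<=` subspace_span X.
Proof. exact: sub_gen_smallest. Qed.

Lemma span_subset X W : submodule W -> X `<=` W -> subspace_span X `<=` W.
Proof. by move=> /submod_closedP sW; apply: smallest_sub. Qed.

End Submodules.

(** Since [alg_hom] gives linearity of a bare function, the usual laws are recovered here without a
    bundled structure. *)
Lemma linear_facts (k : fieldType) (U V : lmodType k) (f : U -> V) :
  linear f -> [/\ f 0 = 0, {morph f : x y / x + y}, {morph f : x y / x - y}
    & forall a, {morph f : x / a *: x}].
Proof.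
move=> fL; have f0 : f 0 = 0.
  have := fL 1 0 0; rewrite !scale1r addr0 => /esym/eqP.
  by rewrite -[X in _ == X]addr0 (inj_eq (addrI _)) => /eqP.
split=> // [x y|x y|a x].
- by rewrite -[x]scale1r fL !scale1r.
- by rewrite addrC -scaleN1r fL scaleN1r addrC.
- by rewrite -[_ *: x]addr0 fL f0 addr0.
Qed.

Lemma submodule_image (k : fieldType) (U V : lmodType k) (f : U -> V) W :
  linear f -> submodule W -> submodule (f @` W).
Proof.
move=> fL [W0 WL]; have [f0 _ _ _] := linear_facts fL.
split; first by exists 0.
move=> a _ _ [x Wx <-] [y Wy <-]; exists (a *: x + y); first exact: WL.
exact: fL.
Qed.

Lemma submodule_preimage (k : fieldType) (U V : lmodType k) (f : U -> V) W :
  linear f -> submodule W -> submodule (f @^-1` W).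
Proof.
move=> fL [W0 WL]; have [f0 _ _ _] := linear_facts fL.
by split=> [|a x y Wx Wy] /=; rewrite ?f0 ?fL//; apply: WL.
Qed.

(** * Chain conditions in finite-dimensional spaces *)

Section FiniteDimensional.
Variables (k : fieldType) (V : vectType k).
Implicit Types W : set V.

(** Take [U] of maximal dimension inside [W]: adjoining a vector of [W] stays inside [W], so it
    cannot enlarge [U]. *)
Lemma submodule_vspace W : submodule W ->
  exists U : {vspace V}, forall x, W x <-> x \in U.
Proof.
move=> sW; pose P n := `[<exists2 U : {vspace V}, \dim U = n &
  forall x, x \in U -> W x>].
have exP : exists n, P n.
  exists 0; apply/asboolP; exists 0%VS; first by rewrite dimv0.
  by move=> x; rewrite memv0 => /eqP->; case: sW.
have ubP n : P n -> (n <= \dim {:V})%N.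
  by move=> /asboolP[U <- _]; apply: dimvS; apply: subvf.
have [n /asboolP[U dimU UW] max_n] := ex_maxnP exP ubP.
exists U => x; split=> [Wx|]; last exact: UW.
have /asboolP/max_n : exists2 U' : {vspace V}, \dim U' = \dim (U + <[x]>)%VS &
    forall x, x \in U' -> W x.
  exists (U + <[x]>)%VS => // _ /memv_addP[y Uy [_ /vlineP[a ->] ->]].
  by apply: submoduleD => //; [apply: UW|apply: submoduleZ].
rewrite -dimU => dimle; have /eqP -> : (U == U + <[x]>)%VS.
  by rewrite eqEdim addvSl.
by apply: (subvP (addvSr _ _)); apply: memv_line.
Qed.

Lemma submodule_dim : exists2 d : set V -> nat,
  (forall W, submodule W -> (d W <= \dim {:V})%N) &
  (forall W W', submodule W -> submodule W' -> W `<=` W' ->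
     (d W <= d W')%N /\ ((d W' <= d W)%N -> W' `<=` W)).
Proof.
have /choice[u uP] : forall W, exists U : {vspace V},
    submodule W -> forall x, W x <-> x \in U.
  move=> W; have [/submodule_vspace[U WU]|] := pselect (submodule W).
    by exists U.
  by exists 0%VS.
exists (fun W => \dim (u W)) => [W sW|W W' sW sW' WW'].
  by apply: dimvS; apply: subvf.
have [WU WU'] := (uP W sW, uP W' sW').
have uu' : (u W <= u W')%VS by apply/subvP => x /WU/WW'/WU'.
split; first exact: dimvS.
move=> dimle x /WU' Ux; apply/WU.
by have /eqP -> : u W == u W' by rewrite eqEdim uu'.
Qed.

Lemma submodule_dcc (I : Type) (P : set I) (U : I -> set V) :
  P !=set0 -> (forall i, P i -> submodule (U i)) ->
  exists2 i0, P i0 & forall i, P i -> U i `<=` U i0 -> U i0 `<=` U i.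
Proof.
move=> [j Pj] sU; have [d _ dP] := submodule_dim.
have exP : exists n, `[<exists2 i, P i & d (U i) = n>].
  by exists (d (U j)); apply/asboolP; exists j.
have [n /asboolP[i0 Pi0 <-] min_n] := ex_minnP exP.
exists i0 => // i Pi Ui; have [_] := dP _ _ (sU i Pi) (sU i0 Pi0) Ui; apply.
by apply: min_n; apply/asboolP; exists i.
Qed.

Lemma submodule_acc (U : nat -> set V) :
  (forall n, submodule (U n)) -> (forall n, U n `<=` U n.+1) ->
  exists n, U n.+1 `<=` U n.
Proof.
move=> sU Uinc; have [d dle dP] := submodule_dim.
have exP : exists n, `[<exists i, d (U i) = n>].
  by exists (d (U 0)); apply/asboolP; exists 0.
have ubP n : `[<exists i, d (U i) = n>] -> (n <= \dim {:V})%N.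
  by move=> /asboolP[i <-]; apply: dle.
have [n /asboolP[i <-] max_n] := ex_maxnP exP ubP.
exists i; have [_] := dP _ _ (sU i) (sU i.+1) (Uinc i); apply.
by apply: max_n; apply/asboolP; exists i.+1.
Qed.

Lemma submodule_basis W : submodule W -> exists r (b : 'I_r -> V),
  forall x, W x <-> exists a : 'I_r -> k, x = \sum_j a j *: b j.
Proof.
move=> /submodule_vspace[U WU].
exists (\dim U), (fun j => (vbasis U)`_j) => x; split=> [/WU Ux|[a ->]].
  by exists (fun j => coord (vbasis U) j x); apply: coord_vbasis.
apply/WU/rpred_sum => j _; apply: rpredZ.
by apply: vbasis_mem; apply: mem_nth; rewrite size_tuple.
Qed.

End FiniteDimensional.

(* The kernels of [phi \o T^n] form an increasing chain of subspaces of [E]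
   containing [ker phi], hence stationary. *)
Lemma surjective_hopfian (k : fieldType) (E : lmodType k) (V : vectType k)
    (phi : E -> V) (T : E -> E) :
  linear phi -> linear T -> (forall y, exists x, T x = y) ->
  (forall x, phi x = 0 -> phi (T x) = 0) ->
  forall x, phi (T x) = 0 -> phi x = 0.
Proof.
move=> phiL TL Tsurj Tker x phiTx.
have [phi0 phiD phiB phiZ] := linear_facts phiL.
have [T0 TD TB TZ] := linear_facts TL.
pose K n := [set x | phi (iter n T x) = 0].
have TnL n : linear (iter n T) by elim: n => // n IH a u v; rewrite /= IH TL.
have sK n : submodule (K n).
  have [Tn0 _ _ _] := linear_facts (TnL n).
  split=> [|a u v]; rewrite /K /= ?Tn0// TnL phiL => -> ->.
  by rewrite scaler0 addr0.
have kerK n z : phi z = 0 -> K n z by elim: n => //= n IH /IH/Tker.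
(* [E] may be infinite-dimensional, so the chain is compared through its images under [phi]; nothing
   is lost, as every [K n] contains the kernel of [phi]. *)
have [n KS] : exists n, phi @` K n.+1 `<=` phi @` K n.
  apply: (submodule_acc (U := fun n => phi @` K n)) => n.
    exact: submodule_image.
  by apply: image_subset => z; apply: Tker.
have iter_surj m y : exists z, iter m T z = y.
  elim: m y => [|m IH] y; first by exists y.
  by have [y' <-] := Tsurj y; have [z <-] := IH y'; exists z.
(* Pulling [x] back along [T^n] puts [z] in [K n.+1]; that [z] is already in [K n] is the claim
   [phi x = 0]. *)
have [z zx] := iter_surj n x.
have [z' Kz' zz'] : (phi @` K n) (phi z).
  by apply: KS; exists z => //; rewrite /K /= zx.
rewrite -zx -(subrK z' z); apply: (submoduleD (sK n)) => //.
by apply: kerK; rewrite phiB zz' subrr.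
Qed.

(** * Linear compactness through maximal filter bases of affine subspaces *)

Section LinearCompactness.
Variables (k : fieldType) (E : lmodType k).
Implicit Types (C G : set E) (F : set (set E)).

(** The three-point form characterizes translates of subspaces over every field, the two-element one
    included; the empty set is allowed. *)
Definition affine C : Prop :=
  forall a x y z, C x -> C y -> C z -> C (a *: (x - y) + z).

Definition affine_filter_base F : Prop :=
  (forall C, F C -> affine C /\ C !=set0) /\
  (forall C C', F C -> F C' -> exists2 G, F G & G `<=` C `&` C').

Lemma maximal_affine_filter_base F0 : affine_filter_base F0 ->
  exists F, [/\ F0 `<=` F, affine_filter_base F &
    forall F', F `<=` F' -> affine_filter_base F' -> F' `<=` F].
Proof.
(* Adjoining [F0] inside [P] makes the empty chain satisfy Zorn's hypothesis. *)
move=> bF0; pose P F := affine_filter_base (F `|` F0).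
have chainP (FF : set (set (set E))) : FF `<=` P -> total_on FF subset ->
    P (\bigcup_(F in FF) F).
  move=> FFP FFtot; split=> [C [[F FF_F FC]|F0C]|].
  - by have [+ _] := FFP _ FF_F; apply; left.
  - by case: bF0 => + _; apply.
  move=> C C' [[F FF_F FC]|F0C] [[F' FF_F' FC']|F0C'].
  - have [le|le] := FFtot _ _ FF_F FF_F'.
      have [_ /(_ C C')[||G FG GC]] := FFP _ FF_F'; try by left; auto.
      by exists G => //; case: FG; [left; exists F'|right].
    have [_ /(_ C C')[||G FG GC]] := FFP _ FF_F; try by left; auto.
    by exists G => //; case: FG; [left; exists F|right].
  - have [_ /(_ C C')[||G FG GC]] := FFP _ FF_F; [by left|by right|].
    by exists G => //; case: FG; [left; exists F|right].
  - have [_ /(_ C C')[||G FG GC]] := FFP _ FF_F'; [by right|by left|].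
    by exists G => //; case: FG; [left; exists F'|right].
  - have [_ /(_ C C' F0C F0C')[G F0G GC]] := bF0.
    by exists G => //; right.
have [F [PF maxF]] := Zorn_bigcup chainP.
exists (F `|` F0); split=> // F' FF' bF' C F'C.
have F'E : F' `|` F0 = F'.
  by apply/seteqP; split=> [C' [//|F0C']|C' ?]; [apply: FF'; right|left].
have [//|nFC] := pselect ((F `|` F0) C).
case: (maxF F'); last by rewrite /P F'E.
split=> [C' FC'|F'F]; first by apply: FF'; left.
by apply: nFC; left; apply: F'F.
Qed.

Lemma affine_filter_base_adjoin F C : affine_filter_base F -> affine C ->
  (forall G, F G -> C `&` G !=set0) ->
  affine_filter_base (F `|` [set C `&` G | G in F]).
Proof.
move=> [Fne Fdir] aC meet; split=> [_ [/Fne//|[G FG <-]]|].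
  split; last exact: meet.
  have [aG _] := Fne _ FG.
  by move=> a x y z [? ?] [? ?] [? ?]; split; [apply: aC|apply: aG].
have lift (G : set E) : (F `|` [set C `&` G | G in F]) G ->
    exists2 G', F G' & C `&` G' `<=` G.
  by move=> [FG|[G' FG' <-]]; [exists G => // ? []|exists G'].
move=> G1 G2 /lift[G1' FG1' sG1] /lift[G2' FG2' sG2].
have [G FG sG] := Fdir _ _ FG1' FG2'.
exists (C `&` G); first by right; exists G.
by move=> x [Cx /sG[? ?]]; split; [apply: sG1|apply: sG2].
Qed.

(* In the maximal filter base, a member whose image under [q] has directions of
   minimal dimension has the least image. *)
Lemma maximal_affine_filter_fiber (V : vectType k) (q : E -> V) F :
  linear q -> F !=set0 -> affine_filter_base F ->
  (forall F', F `<=` F' -> affine_filter_base F' -> F' `<=` F) ->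
  exists x0, exists2 G, F G & forall x, G x -> q x = q x0.
Proof.
move=> qL [G0 FG0] bF maxF; have [Fne Fdir] := bF.
have [q0 qD qB qZ] := linear_facts qL.
pose dir G : set V := [set v | exists x y, [/\ G x, G y & v = q (x - y)]].
have dirP G : F G -> submodule (dir G).
  move=> /Fne[aG [z Gz]]; split; first by exists z, z; split; rewrite ?subrr.
  move=> a _ _ [x1 [y1 [Gx1 Gy1 ->]]] [x2 [y2 [Gx2 Gy2 ->]]].
  exists (a *: (x1 - y1) + x2), y2; split=> //; first exact: aG.
  by rewrite -addrA qL.
have [|C FC minC] := submodule_dcc (P := F) _ dirP; first by exists G0.
have [aC [x0 Cx0]] := Fne _ FC.
pose H := [set x | q x = q x0].
have aH : affine H.
  by move=> a x y z; rewrite /H /= qL qB => -> -> ->; rewrite subrr scaler0 add0r.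
have meet G : F G -> H `&` G !=set0.
  move=> FG; have [G' FG' sG'] := Fdir _ _ FC FG.
  have [aG' [x1 G'x1]] := Fne _ FG'.
  (* By minimality [G'] has all the directions of [C] under [q]; translating [x1] by [u - v]
     therefore reaches the fiber of [x0] inside [G']. *)
  have [||u [v [G'u G'v]]] := minC _ FG' _ (q (x0 - x1)).
  - by move=> _ [x [y [/sG'[Cx _] /sG'[Cy _] ->]]]; exists x, y.
  - by exists x0, x1; split=> //; have [] := sG' _ G'x1.
  rewrite !qB => /eqP; rewrite subr_eq => /eqP quv.
  exists (1 *: (u - v) + x1); split.
    by rewrite /H /= scale1r qD qB quv.
  by have [] := sG' _ (aG' 1 _ _ _ G'u G'v G'x1).
exists x0, (H `&` C) => [|x []//].
apply: (maxF _ _ (affine_filter_base_adjoin bF aH meet)); first by left.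
by right; exists C.
Qed.

(** A maximal filter base has, for each [i], a member on which [q i] is constant. Members for two
    indices meet, so these constants are pairwise compatible and come from one [e]; members also
    meet each [C], so [e] is in the closure of [C]. *)
Lemma linearly_compact (I : Type) (V : I -> vectType k)
    (q : forall i, E -> V i) F0 :
  (forall i, linear (q i)) ->
  (forall c : I -> E,
    (forall i j, exists z, q i z = q i (c i) /\ q j z = q j (c j)) ->
    exists e, forall i, q i e = q i (c i)) ->
  F0 !=set0 -> affine_filter_base F0 ->
  exists e, forall C, F0 C -> forall i, exists2 x, C x & q i x = q i e.
Proof.
move=> qL complete [C0 F0C0] /maximal_affine_filter_base[F [F0F bF maxF]].
have Fn0 : F !=set0 by exists C0; apply: F0F.
have [Fne Fdir] := bF.
have /choice[c cP] i :=
  maximal_affine_filter_fiber (qL i) Fn0 bF maxF.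
have [i j|e eP] := complete c.
  have [G FG Gi] := cP i; have [G' FG' Gj] := cP j.
  have [G2 FG2 sG2] := Fdir _ _ FG FG'; have [_ [z G2z]] := Fne _ FG2.
  by exists z; have [? ?] := sG2 _ G2z; split; [apply: Gi|apply: Gj].
exists e => C /F0F FC i; have [G FG Gi] := cP i.
have [G2 FG2 sG2] := Fdir _ _ FG FC; have [_ [z G2z]] := Fne _ FG2.
by have [Gz Cz] := sG2 _ G2z; exists z => //; rewrite eP; apply: Gi.
Qed.

End LinearCompactness.

(** * The descending chain of ideals [npow] *)

Section NPow.
Variables (k : fieldType) (A : naAlgType k).
Implicit Types (x y z : A) (W : set A).

Lemma linear_namulr x : linear (namul x).
Proof. by move=> a y z; exact: (namul_bilinear (s := A)).2. Qed.

Lemma linear_namull y : linear (namul^~ y).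
Proof. by move=> a x z; exact: (namul_bilinear (s := A)).1. Qed.

Lemma npow_succ_sub n W : (0 < n)%N -> submodule W ->
  (forall m l x y, (0 < m)%N -> (0 < l)%N -> (m + l)%N = n.+1 ->
     npow m x -> npow l y -> W (x ** y)) ->
  npow n.+1 `<=` W.
Proof.
move=> n0 sW Wmul; rewrite npowS//; apply: span_subset => // z.
move=> [m /andP[m0 mn]]; apply: (span_subset sW) => _ [x [y [Ax Ay ->]]].
apply: Wmul Ax Ay => //; first by rewrite subn_gt0.
by rewrite subnKC// ltnW.
Qed.

Lemma submodule_npow n : submodule (npow n : set A).
Proof. by case: n => [//|[//|n]]; rewrite npowS//; apply: submodule_span. Qed.

Lemma npow_mul m l x y : (0 < m)%N -> (0 < l)%N ->
  npow m x -> npow l y -> npow (m + l) (x ** y).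
Proof.
move=> m0 l0 Ax Ay.
have -> : (m + l)%N = (m + l).-1.+1 by rewrite prednK// addn_gt0 m0.
rewrite npowS; last by case: m l m0 l0 {Ax Ay} => [|m] [|l]//; rewrite addnS.
apply: subset_span; exists m; rewrite /= prednK ?addn_gt0 ?m0//=.
  by rewrite -[X in (X < _)%N]addn0 ltn_add2l.
by apply: subset_span; exists x, y; split=> //; rewrite addKn.
Qed.

(** In a product of total degree at least 3, some factor has degree at least 2, and induction lowers
    that degree by one. *)
Lemma npow_antitone m n : (0 < m <= n)%N -> npow n `<=` (npow m : set A).
Proof.
suff step i : (0 < i)%N -> npow i.+1 `<=` (npow i : set A).
  move=> /andP[m0 /subnK <-]; elim: (n - m)%N => // i IH x Ax.
  by apply: IH; apply: step; rewrite // addn_gt0 m0 orbT.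
elim/ltn_ind: i => -[//|[//|i]] IH _.
apply: npow_succ_sub => // [|m' l x y m0 l0 ml Ax Ay].
  exact: submodule_npow.
have [m1|] := ltnP 1 m'.
  have -> : i.+2 = (m'.-1 + l)%N by case: m' m1 ml {m0 Ax} => // m' _ [].
  apply: npow_mul => //; first by case: m' m1 {ml m0 Ax} => [|[]].
  case: m' m1 ml {m0} Ax => [//|[//|m']] _ ml; apply: IH => //.
  by move: ml; rewrite addSn => -[<-]; rewrite -[X in (X < _)%N]addn0 ltn_add2l.
case: m' m0 ml Ax => [|[|]]// _ [ll] Ax _.
rewrite add0n in ll; rewrite ll in Ay *.
by rewrite -[i.+2]add1n; apply: npow_mul => //; apply: IH.
Qed.

End NPow.

(** * Homomorphisms respect the chain [npow] *)

Section Homomorphisms.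
Variables (k : fieldType) (A B : naAlgType k) (f : A -> B).
Hypothesis f_hom : alg_hom f.

Lemma npow_hom n x : (0 < n)%N -> npow n x -> npow n (f x).
Proof.
have [fL fM] := f_hom.
elim/ltn_ind: n x => -[//|[//|n]] IH x _; move: x.
apply: npow_succ_sub => //.
  by apply: (submodule_preimage fL); apply: submodule_npow.
move=> m l x y m0 l0 ml Ax Ay; rewrite /= fM -ml.
apply: npow_mul => //; apply: IH => //; rewrite -ml.
  by rewrite -[X in (X < _)%N]addn0 ltn_add2l.
by rewrite -[X in (X < _)%N]add0n ltn_add2r.
Qed.

End Homomorphisms.

(** * Evaluation of monomials and the consequences of separativity *)

Section Separation.
Variables (k : fieldType) (A : naAlgType k) (e : nat -> A).
Implicit Types (u v w : monomial) (p q : {malg k[monomial]}).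

Lemma mlength_gt0 w : (0 < mlength w)%N.
Proof. by elim: w => //= u u0 v v0; rewrite addn_gt0 u0. Qed.

(** Homogeneity speaks of occurrences and separation of lengths; this links the two, with [N] a
    bound on the variables of [w]. *)
Lemma occurrences_mlength w : exists N, forall M, (N <= M)%N ->
  (\sum_(i < M) occurrences i w)%N = mlength w.
Proof.
elim: w => [j|u [N1 H1] v [N2 H2]].
  exists j.+1 => M jM; rewrite (bigD1 (Ordinal jM))//= eqxx big1 ?addn0// => i.
  by rewrite -val_eqE /= => /negPf->.
exists (maxn N1 N2) => M; rewrite geq_max => /andP[? ?].
by rewrite big_split/= H1 ?H2.
Qed.

Lemma eq_occurrences_mlength u v :
  (forall i, occurrences i u = occurrences i v) -> mlength u = mlength v.
Proof.
move=> uv; have [N1 H1] := occurrences_mlength u.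
have [N2 H2] := occurrences_mlength v.
rewrite -(H1 (maxn N1 N2)) ?leq_maxl// -(H2 (maxn N1 N2)) ?leq_maxr//.
by apply: eq_bigr => i _; apply: uv.
Qed.

(** Restricting to one degree stays linear in [p] and still kills homogeneous identities, whose
    monomials share one length. Congruences can thus be used degree by degree. *)
Definition eval_degree n p : A :=
  \sum_(w <- msupp p | mlength w == n) p@_w *: eval_monomial e w.

Lemma eval_degreeEw n p (D : {fset monomial}) : (msupp p `<=` D)%fset ->
  eval_degree n p = \sum_(w <- D | mlength w == n) p@_w *: eval_monomial e w.
Proof.
move=> pD; rewrite /eval_degree big_mkcond [RHS]big_mkcond.
apply: big_fset_incl => // w _ /mcoeff_outdom ->.
by rewrite scale0r if_same.
Qed.

Lemma linear_eval_degree n : linear (eval_degree n).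
Proof.
move=> a p q; pose D := (msupp p `|` msupp q)%fset.
rewrite !(@eval_degreeEw _ _ D) ?fsubsetUl ?fsubsetUr//; last first.
  apply: fsubset_trans (msuppD_le _ _) _.
  by apply: fsetUSS => //; apply: msuppZ_le.
rewrite scaler_sumr -big_split/=; apply: eq_bigr => w _.
by rewrite mcoeffD mcoeffZ scalerDl scalerA.
Qed.

Lemma eval_degreeU w : eval_degree (mlength w) << w >> = eval_monomial e w.
Proof.
rewrite /eval_degree msuppU oner_eq0 big_mkcond big_seq_fset1 eqxx mcoeffUU.
exact: scale1r.
Qed.

Lemma eval_degree_homogeneous n p :
  homogeneous p -> satisfies A p -> eval_degree n p = 0.
Proof.
move=> hp sp; have [[u up un]|no] :=
  pselect (exists2 u, u \in msupp p & mlength u = n); last first.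
  rewrite /eval_degree big_seq_cond big1 // => w /andP[wp /eqP wn].
  by case: no; exists w.
rewrite -[RHS](sp e) /eval_degree big_seq_cond [RHS]big_seq.
apply: eq_bigl => w; case: (boolP (w \in msupp p)) => //= wp.
by rewrite -un; apply/eqP/eq_occurrences_mlength/hp.
Qed.

Lemma eval_congruent V p q : V A -> congruent_mod_homogeneous V p q ->
  forall n, eval_degree n p = eval_degree n q.
Proof.
move=> VA pq n; apply/eqP; rewrite -subr_eq0; apply/eqP.
have L := linear_eval_degree n; have [_ _ LB _] := linear_facts L.
rewrite -LB; apply: (span_subset (W := [set h | eval_degree n h = 0]) _ _ pq).
  by apply: (submodule_preimage L (W := [set 0])); split=> // a x y -> ->;
     rewrite scaler0 addr0.
by move=> h [hh /(_ _ VA) hV]; apply: eval_degree_homogeneous.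
Qed.

(** The index is the total length of the multipliers, that is, the degree which the operator
    adds. *)
Inductive mulop : nat -> (A -> A) -> Prop :=
| mulop_id : mulop 0 id
| mulop_l w m f : mulop m f ->
    mulop (mlength w + m) (fun x => eval_monomial e w ** f x)
| mulop_r w m f : mulop m f ->
    mulop (mlength w + m) (fun x => f x ** eval_monomial e w).

Lemma mulop_comp m n f g : mulop m f -> mulop n g -> mulop (m + n) (f \o g).
Proof.
by move=> + mg; elim=> [|w {}m {}f _ IH|w {}m {}f _ IH]; rewrite -?addnA//;
  [apply: (mulop_l w IH)|apply: (mulop_r w IH)].
Qed.

Lemma linear_mulop m f : mulop m f -> linear f.
Proof.
elim=> [//|w {}m {}f _ IH a x y|w {}m {}f _ IH a x y]; rewrite IH.
  exact: linear_namulr.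
exact: linear_namull.
Qed.

Lemma mulop_ker (B : naAlgType k) (h : A -> B) m f x : alg_hom h ->
  mulop m f -> h x = 0 -> h (f x) = 0.
Proof.
move=> [_ hM] + hx; elim=> [//|w {}m {}f _ IH|w {}m {}f _ IH].
all: rewrite hM IH.
  by have [-> _ _ _] := linear_facts (linear_namulr (h (eval_monomial e w))).
by have [-> _ _ _] := linear_facts (linear_namull (h (eval_monomial e w))).
Qed.

Lemma npow_eval w : npow (mlength w) (eval_monomial e w).
Proof. by elim: w => // u IHu v IHv; apply: npow_mul; rewrite ?mlength_gt0. Qed.

Lemma npow_mulop m f n x : mulop m f -> (0 < n)%N -> npow n x ->
  npow (m + n) (f x).
Proof.
move=> + n0 Ax; elim=> [//|w {}m {}f _ IH|w {}m {}f _ IH]; last first.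
  rewrite -addnA addnC; apply: npow_mul => //; rewrite ?addn_gt0 ?n0 ?orbT//.
    exact: mlength_gt0.
  exact: npow_eval.
rewrite -addnA; apply: npow_mul => //; rewrite ?addn_gt0 ?n0 ?orbT//.
  exact: mlength_gt0.
exact: npow_eval.
Qed.

(** On the way up from [u] to [w] in the tree, each sibling subtree contributes one left or right
    multiplication. *)
Lemma submonomial_mulop u w : u \in submonomials w ->
  exists m f, [/\ mulop m f, (mlength u + m)%N = mlength w &
    eval_monomial e w = f (eval_monomial e u)].
Proof.
elim: w => [j|w1 IH1 w2 IH2].
  by rewrite inE => /eqP->; exists 0, id; split=> //; exact: mulop_id.
rewrite /= inE mem_cat => /orP[/eqP->|/orP[/IH1|/IH2] [m [f [mf um ev]]]].
- by exists 0, id; split; rewrite ?addn0//; exact: mulop_id.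
- exists (mlength w2 + m), (fun x => f x ** eval_monomial e w2); split.
  + exact: mulop_r.
  + by rewrite addnCA um addnC.
  + by rewrite ev.
- exists (mlength w1 + m), (fun x => eval_monomial e w1 ** f x); split.
  + exact: mulop_l.
  + by rewrite addnCA um.
  + by rewrite ev.
Qed.

Definition mulop_values n d : set A := [set x | exists m f v,
  [/\ (n <= m <= n + d)%N, mulop m f & x = f (eval_monomial e v)]].

(** Induction on [n]: only operators of degree exactly [n] leave the next window. Separativity
    rewrites their argument, adding a degree between 1 and [1 + d], which lands between [n + 1] and
    [n + 1 + d]. *)
Lemma eval_mulop_values V d n w : V A -> interval_separative d V ->
  (n < mlength w)%N ->
  subspace_span (mulop_values n d) (eval_monomial e w).
Proof.
move=> VA sepV.
(* The stronger claim records the total length, which the induction needs to know that the inner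
   monomial has length greater than 1. *)
suff: (n < mlength w)%N -> subspace_span [set x | exists m f v,
    [/\ (n <= m <= n + d)%N, mulop m f, (mlength v + m)%N = mlength w
      & x = f (eval_monomial e v)]] (eval_monomial e w).
  move=> H /H; apply: span_subset; first exact: submodule_span.
  move=> x [m [f [v [? ? _ ?]]]]; apply: subset_span; by exists m, f, v.
elim: n => [|n IH] nw.
  apply: subset_span; exists 0, id, w; rewrite addn0.
  by split=> //; exact: mulop_id.
have := IH (ltnW nw); apply: span_subset; first exact: submodule_span.
move=> _ [m [f [v [/andP[nm mnd] mf vm ->]]]].
have [ltnm|] := ltnP n m.
  apply: subset_span; exists m, f, v; split=> //.
  by rewrite ltnm addSn (leq_trans mnd).
move=> mn; have {nm mn mnd} m_n : m = n by apply/eqP; rewrite eqn_leq mn nm.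
subst m; have v1 : (1 < mlength v)%N.
  by move: nw; rewrite -vm -[n.+1]add1n ltn_add2r.
have [p psep /(eval_congruent VA)/(_ (mlength v))] := sepV v v1.
rewrite eval_degreeU => ->; have fL := linear_mulop mf.
(* Only the terms of [p] with the length of [v] remain, so the total length is preserved. *)
rewrite /eval_degree big_seq_cond.
set Z := subspace_span _; apply: (@submodule_sum _ _ (f @^-1` Z)).
  by apply: (submodule_preimage fL); exact: submodule_span.
move=> u /andP[/psep[m' /andP[m'0 m'd] [v' v'u lenv']] /eqP uv].
have [_ _ _ fZ] := linear_facts fL; rewrite /= fZ.
apply: (@submoduleZ _ _ Z); first exact: submodule_span.
apply: subset_span; have [m2 [g [mg lenv2 ->]]] := submonomial_mulop v'u.
have m2E : m2 = m' by apply/eqP; rewrite -(eqn_add2l (mlength v')) lenv2 lenv'.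
subst m2; exists (n + m')%N, (f \o g), v'; split => //.
- by rewrite -addn1 leq_add2l m'0 -addnA leq_add2l.
- exact: mulop_comp.
- by rewrite addnCA lenv' uv addnC.
Qed.

Hypothesis fin_e : finite_set (range e).

Lemma finite_eval n :
  finite_set [set x | exists2 w, (mlength w <= n)%N & x = eval_monomial e w].
Proof.
elim: n => [|n IH].
  by apply: sub_finite_set (@finite_set0 A) => x [w]; rewrite leqn0 => /eqP w0;
    have := mlength_gt0 w; rewrite w0.
set X := [set x | _] in IH.
apply: (@sub_finite_set _ _ (range e `|` (fun xy => xy.1 ** xy.2) @` (X `*` X))).
  move=> x [[j _ ->|u v /= uvn ->]]; first by left; exists j.
  right; exists (eval_monomial e u, eval_monomial e v) => //; split=> /=.
    exists u => //; rewrite -ltnS (leq_trans _ uvn)//.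
    by rewrite -[X in (X < _)%N]addn0 ltn_add2l mlength_gt0.
  exists v => //; rewrite -ltnS (leq_trans _ uvn)//.
  by rewrite -[X in (X < _)%N]add0n ltn_add2r mlength_gt0.
by rewrite finite_setU; split=> //; apply/finite_image/finite_setX.
Qed.

Lemma finite_mulop n :
  finite_set [set f | exists2 m, (m <= n)%N & mulop m f].
Proof.
elim: n => [|n IH].
  apply: (@sub_finite_set _ _ [set id]); last exact: finite_set1.
  move=> f [m]; rewrite leqn0 => /eqP m0 mf; case: mf m0 => //= w m' f' _.
    by have := mlength_gt0 w; case: mlength.
  by have := mlength_gt0 w; case: mlength.
set F := [set f | _] in IH.
pose X := [set x | exists2 w, (mlength w <= n.+1)%N & x = eval_monomial e w].
have finX : finite_set X by exact: finite_eval.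
apply: (@sub_finite_set _ _ ([set id] `|`
  ((fun xf => (fun y => xf.1 ** xf.2 y)) @` (X `*` F) `|`
   (fun xf => (fun y => xf.2 y ** xf.1)) @` (X `*` F)))).
  have len w m : (mlength w + m <= n.+1)%N -> (mlength w <= n.+1)%N /\ (m <= n)%N.
    move=> le; split; first by rewrite (leq_trans _ le) ?leq_addr.
    rewrite -ltnS (leq_trans _ le)// -[X in (X < _)%N]add0n ltn_add2r.
    exact: mlength_gt0.
  move=> f [m mn mf]; case: mf mn => [_|w m' f' mf' /len[wn m'n]|
    w m' f' mf' /len[wn m'n]]; [by left|right; left|right; right];
  by exists (eval_monomial e w, f') => //; split; [exists w|exists m'].
rewrite !finite_setU; split; first exact: finite_set1.
by split; apply/finite_image/finite_setX.
Qed.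

End Separation.

(** * Closed and open subspaces of an inverse limit *)

Section InverseLimit.
Variables (k : fieldType) (D : inv_system k) (A : naAlgType k).
Variable pi : forall i : ix D, A -> obj i.
Hypothesis D_findim : forall i : ix D, finite_dim (obj i).
Hypothesis A_lim : is_inverse_limit pi.

Let pi_hom i : alg_hom (pi i). Proof. by case: A_lim. Qed.

Let piL i : linear (pi i). Proof. by case: (pi_hom i). Qed.

Let piB i : {morph pi i : x y / x - y}.
Proof. by have [_ _ ] := linear_facts (@piL i). Qed.

Lemma tr_projection i j (ij : (i <= j)%O) a : tr ij (pi i a) = pi j a.
Proof. by case: A_lim => _ [+ _ _] => /(_ a I); apply. Qed.

Lemma projection_inj x y : (forall i, pi i x = pi i y) -> x = y.
Proof.
case: A_lim => _ [_ inj _] xy; apply: inj; rewrite ?in_setT//.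
exact: functional_extensionality_dep.
Qed.

Lemma projection_le i j x y : (i <= j)%O -> pi i x = pi i y -> pi j x = pi j y.
Proof. by move=> ij xy; rewrite -!(tr_projection ij) xy. Qed.

(** A transition map involves only two indices, so pairwise compatibility is enough. *)
Lemma inverse_limit_complete (c : ix D -> A) :
  (forall i j, exists z, pi i z = pi i (c i) /\ pi j z = pi j (c j)) ->
  exists a, forall i, pi i a = pi i (c i).
Proof.
case: A_lim => _ [_ _ surj] cc.
have [|a _ aE] := surj (fun i => pi i (c i)).
  move=> i j ij; have [z [<- <-]] := cc i j; exact: tr_projection.
by exists a => i; have := congr1 (fun f => f i) aE.
Qed.

(** The solution sets of [F x = y] modulo each [ker pi_i] form a filter base of affine subspaces;
    linear compactness gives a common solution. *)
Lemma closed_image r (F : {ffun 'I_r -> A} -> A) y : linear F ->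
  (forall i (x : {ffun 'I_r -> A}),
     (forall j, pi i (x j) = 0) -> pi i (F x) = 0) ->
  (forall i, exists x, pi i (F x) = pi i y) -> exists x, F x = y.
Proof.
move=> FL Fker Fy.
(* Coordinates replace [obj i] by row vectors, which carry the [vectType] structure that linear
   compactness asks for. *)
have embed (i : ix D) : {n & {g : obj i -> 'rV[k]_n | linear g /\ injective g}}.
  have /cid[n /cid gn] : exists n (g : obj i -> 'rV[k]_n), linear g /\ injective g.
    have [n [[g gL gB]]] := D_findim i; exists n, g; split=> //.
    exact: bij_inj.
  by exists n.
pose n i := projT1 (embed i); pose g i := sval (projT2 (embed i)).
have gP i : linear (g i) /\ injective (g i) := svalP (projT2 (embed i)).
pose q i (x : {ffun 'I_r -> A}) : 'M[k]_(r, n i) := \matrix_j g i (pi i (x j)).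
have qP i x x' : q i x = q i x' <-> forall j, pi i (x j) = pi i (x' j).
  split=> [/row_matrixP + j|xx']; last first.
    by apply/row_matrixP => j; rewrite !rowK xx'.
  by move/(_ j); rewrite !rowK; have [_] := gP i; apply.
have qL i : linear (q i).
  move=> a x x'; apply/row_matrixP => j; have [gL _] := gP i.
  by rewrite linearP /= !rowK !ffunE piL gL.
pose X i := [set x | pi i (F x) = pi i y].
have aX : affine_filter_base (range X).
  split=> [_ [i _ <-]|_ _ [i _ <-] [j _ <-]].
    split; last exact: Fy.
    have [_ _ FB _] := linear_facts FL.
    move=> a x x' z; rewrite /X /= FL FB piL piB => -> -> ->.
    by rewrite subrr scaler0 add0r.
  have [l [li lj]] := ix_directed i j; exists (X l); first by exists l.
  by move=> x Xx; split; [apply: projection_le li _|apply: projection_le lj _].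
have [c||x Xx] := linearly_compact qL _ _ aX.
- move=> cc; have /choice[e eP] : forall j, exists a, forall i,
      pi i a = pi i (c i j).
    move=> j; apply: inverse_limit_complete => i i'.
    by have [z [/qP zi /qP zi']] := cc i i'; exists (z j).
  by exists [ffun j => e j] => i; apply/qP => j; rewrite ffunE.
- by have [i] := ix_inhabited D; exists (X i), i.
exists x; apply: projection_inj => i.
have [|x' Xx' /qP xx'] := Xx (X i) _ i; first by exists i.
rewrite -Xx'; apply/eqP; rewrite -subr_eq0 -piB.
have [_ _ <- _] := linear_facts FL; apply/eqP/Fker => j.
by rewrite !ffunE piB xx' subrr.
Qed.

(* Since [k^t] is finite-dimensional, the preimages of [H + ker pi_i] in it have
   a smallest member, say at [i]; then [H + ker pi_l] does not depend on
   [l <= i], hence its closure [H] contains [ker pi_i]. *)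
Lemma closed_finite_codim_open (H : set A) t (b : 'I_t -> A) : submodule H ->
  (forall y, (forall i, exists2 h, H h & pi i h = pi i y) -> H y) ->
  (forall i x, exists (a : 'I_t -> k) h,
     H h /\ pi i x = pi i (\sum_j a j *: b j + h)) ->
  exists i, forall x, pi i x = 0 -> H x.
Proof.
move=> sH Hclosed Hspan.
pose phi (a : 'rV[k]_t) := \sum_j a ord0 j *: b j.
have phiL : linear phi.
  move=> c u v; rewrite /phi scaler_sumr -big_split/=; apply: eq_bigr => j _.
  by rewrite !mxE scalerDl scalerA.
pose N i := [set x | exists2 h, H h & pi i h = pi i x].
have sN i : submodule (N i).
  split; first by exists 0 => //; case: sH.
  move=> c u v [h Hh hu] [h' Hh' hv]; exists (c *: h + h'); first exact: sH.2.
  by rewrite !piL hu hv.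
have [||i _ min_i] := submodule_dcc (P := setT) (U := fun i => phi @^-1` N i).
- by have [i] := ix_inhabited D; exists i.
- by move=> i _; apply: submodule_preimage.
exists i => x xi; apply: Hclosed => l; have [m [mi ml]] := ix_directed i l.
suff [h Hh hx] : N m x by exists h => //; apply: projection_le ml _.
have [a [h [Hh xE]]] := Hspan m x; pose u := \row_j a j.
have phiE : \sum_j a j *: b j = phi u.
  by apply: eq_bigr => j _; rewrite mxE.
(* As [x] vanishes at [i], [phi u] agrees there with [- h]; minimality at [i] then moves it from
   [N i] into [N m]. *)
rewrite phiE in xE; have phiu : N i (phi u).
  have := projection_le mi xE; rewrite xi.
  have [pi0 piD _ _] := linear_facts (@piL i).
  rewrite piD => /esym/eqP; rewrite addr_eq0 => /eqP uh.
  exists (0 - h); first by apply: submoduleB => //; case: sH.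
  by rewrite piB pi0 sub0r uh.
have [|h' Hh' h'E] := min_i m I _ u phiu.
  by move=> v [h' Hh' h'E]; exists h' => //; apply: projection_le mi _.
exists (h' + h); first exact: submoduleD.
by have [_ piD _ _] := linear_facts (@piL m); rewrite xE !piD h'E.
Qed.

Let X := inverse_limit_topology pi.

Lemma open_projection_saturated (U : set A) :
  (forall x, U x -> exists i, forall y, pi i y = pi i x -> U y) ->
  open (U : set X).
Proof.
move=> UP; have cont i : continuous (pi i : X -> discrete_topology (obj i)).
  move=> x; pose h := (fun a i => pi i a) :
    A -> prod_topology (fun i : ix D => discrete_topology (obj i)).
  apply: (@continuous_comp X _ _ (h : X -> _) (proj i)).
    exact: (@initial_continuous A _ h).
  exact: proj_continuous.
have -> : U = \bigcup_(V in [set V : set X | open V /\ V `<=` U]) V.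
  apply/seteqP; split=> [x Ux|x [V [_ VU] /VU]//].
  have [i iU] := UP _ Ux; exists (pi i @^-1` [set pi i x]) => //; split=> //.
  by have /continuousP := cont i; apply; exact: discrete_open.
by apply: bigcup_open => V [].
Qed.

Lemma dense_projection (S : set A) i x : dense (S : set X) ->
  exists2 s, S s & pi i s = pi i x.
Proof.
move=> Sdense; have [||s [sx Ss]] := Sdense (pi i @^-1` [set pi i x]).
- by exists x.
- by apply: open_projection_saturated => y <-; exists i.
- by exists s.
Qed.

End InverseLimit.

(** * Finite enumerations and finitely generated subalgebras *)

Lemma finite_set_enum (T : eqType) (X : set T) : finite_set X ->
  exists r (s : 'I_r -> T), X = range s.
Proof.
move=> /finite_seqP[s ->]; exists (size s), (tnth (in_tuple s)).
apply/seteqP; split=> [x /= xs|_ [j _ <-]]; last exact: mem_tnth.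
by have /tnthP[j ->] : x \in in_tuple s by []; exists j.
Qed.

Section Generators.
Variables (k : fieldType) (A : naAlgType k).

Lemma subalgebra_span_eval (e : nat -> A) :
  is_subalgebra (subspace_span (range (eval_monomial e))).
Proof.
set X := range _; split; first exact/submod_closedP/submodule_span.
move=> x y Xx Xy; have sX := submodule_span X.
suff: subspace_span X `<=` namul x @^-1` subspace_span X by apply.
apply: span_subset; first exact: submodule_preimage (linear_namulr x) sX.
move=> _ [v _ <-] /=.
suff: subspace_span X `<=` (namul^~ (eval_monomial e v)) @^-1` subspace_span X.
  by apply.
apply: span_subset; first exact: submodule_preimage (linear_namull _) sX.
by move=> _ [u _ <-]; apply: subset_span; exists (MMul u v).
Qed.

Lemma finitely_generated_eval (S : set A) : finitely_generated S ->
  exists2 e : nat -> A, finite_set (range e) &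
    S `<=` subspace_span (range (eval_monomial e)).
Proof.
(* Variables beyond the generators take the default value 0, so the range of the assignment stays
   finite. *)
move=> [X /finite_seqP[s Xs] ->]; exists (nth 0 s).
  apply: (@sub_finite_set _ _ [set` 0 :: s]); last by apply/finite_seqP; exists (0 :: s).
  move=> _ [i _ <-] /=; rewrite inE; have [/(mem_nth 0) ->|] := ltnP i (size s).
    by rewrite orbT.
  by move/(nth_default 0) ->; rewrite eqxx.
apply: smallest_sub; first exact: subalgebra_span_eval.
rewrite Xs => x /= /(nthP 0)[i _ <-].
by apply: subset_span; exists (MVar i).
Qed.

End Generators.

(** * Openness of the ideals [npow] *)

Section OpenPowers.
Variables (k : fieldType) (V : set (naAlgType k)) (A : naAlgType k).
Hypotheses (V_separative : separative V) (A_in_V : V A).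
Variables (D : inv_system k) (pi : forall i : ix D, A -> obj i).
Hypotheses (D_findim : forall i : ix D, finite_dim (obj i))
  (A_lim : is_inverse_limit pi).
Variable S : set A.
Hypotheses (S_fg : finitely_generated S)
  (S_dense : dense (S : set (inverse_limit_topology pi))).

(** Openness is put as containing the kernel of one projection, the form that the continuity claims
    use as well. *)
Lemma npow_contains_ker n : exists i, forall x, pi i x = 0 -> npow n.+1 x.
Proof.
have [d sepV] := V_separative; have [e fin_e Se] := finitely_generated_eval S_fg.
pose M := [set f | exists2 m, (n <= m <= n + d)%N & mulop e m f].
have [r [f Mf]] : exists r (f : 'I_r -> A -> A), M = range f.
  apply: finite_set_enum; apply: sub_finite_set (finite_mulop fin_e (n + d)).
  by move=> f [m /andP[_ mnd] mf]; exists m.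
have fP j : M (f j) by rewrite Mf; exists j.
have fL j : linear (f j) by have [m _ /linear_mulop] := fP j.
have [t [b bE]] := finite_set_enum (finite_eval fin_e n).
pose F (x : {ffun 'I_r -> A}) := \sum_j f j (x j).
have FL : linear F.
  move=> a x y; rewrite /F scaler_sumr -big_split/=; apply: eq_bigr => j _.
  by rewrite !ffunE fL.
have sF : submodule (range F) by apply: (@submodule_image _ _ _ F setT FL); split.
have evalF w : (n < mlength w)%N -> range F (eval_monomial e w).
  move=> nw; apply: (span_subset sF _ (eval_mulop_values A_in_V sepV nw)).
  move=> _ [m [g [v [mnd mg ->]]]].
  have [j _ <-] : range f g by rewrite -Mf; exists m.
  exists [ffun j' => if j' == j then eval_monomial e v else 0] => //.
  rewrite /F (bigD1 j)//= ffunE eqxx big1 ?addr0// => j' /negPf jj'.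
  by rewrite ffunE jj'; have [] := linear_facts (fL j').
have [y yF|i x|i iF] := closed_finite_codim_open A_lim (b := b) sF.
- have [i x xi|i|x Fx] := closed_image D_findim A_lim (F := F) (y := y) FL.
  + have piL : linear (pi i) by case: A_lim => /(_ i)[].
    have [pi0 piD _ _] := linear_facts piL.
    rewrite /F (big_morph (pi i) piD pi0) big1// => j _.
    have [m _ mf] := fP j; apply: mulop_ker mf (xi j).
    by case: A_lim.
  + by have [_ [x _ <-] xy] := yF i; exists x.
  by exists x.
(* Density replaces [x] by some [s] in [S], a combination of monomial values: the long ones lie in
   [range F], the others are listed by [b]. *)
- have [s Ss <-] := dense_projection i x S_dense.
  pose W := [set y | exists (a : 'I_t -> k) h,
    range F h /\ y = \sum_j a j *: b j + h].
  suff /(_ _ (Se _ Ss))[a [h [Fh ->]]] :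
    subspace_span (range (eval_monomial e)) `<=` W by exists a, h.
  apply: span_subset => [|_ [w _ <-]].
    split=> [|c _ _ [a [h [Fh ->]]] [a' [h' [Fh' ->]]]].
      exists (fun=> 0), 0; split; first exact: sF.1.
      by rewrite big1 ?addr0// => j _; rewrite scale0r.
    exists (fun j => c * a j + a' j), (c *: h + h').
    split; first exact: sF.2.
    rewrite scalerDr addrACA scaler_sumr -big_split/=; congr (_ + _).
    by apply: eq_bigr => j _; rewrite scalerDl scalerA.
  have [/evalF Fw|wn] := ltnP n (mlength w).
    exists (fun=> 0), (eval_monomial e w); split=> //.
    by rewrite big1 ?add0r// => j _; rewrite scale0r.
  have [j _ <-] : range b (eval_monomial e w) by rewrite -bE; exists w.
  exists (fun j' => (j' == j)%:R), 0; split; first exact: sF.1.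
  rewrite addr0 (bigD1 j)//= eqxx scale1r big1 ?addr0// => j' /negPf ->.
  by rewrite scale0r.
exists i => _ /iF[x _ <-]; apply: submodule_sum; first exact: submodule_npow.
move=> j _; have [m /andP[nm _] mf] := fP j.
(* An operator of degree [m >= n] sends [A = npow 1] into [npow (m + 1)]. *)
apply: (@npow_antitone _ _ n.+1 (m + 1)); first by rewrite addn1.
exact: (npow_mulop mf).
Qed.

End OpenPowers.

(** * Finite-dimensional images of pro-nilpotent algebras *)

Section FiniteDimensionalImages.
Variables (k : fieldType) (D : inv_system k) (A : naAlgType k).
Variable pi : forall i : ix D, A -> obj i.
Hypotheses (A_lim : is_inverse_limit pi)
  (pi_nilp : forall i, exists n, forall x, npow n.+1 x -> pi i x = 0).

(* The iterates of [x |-> y + T x] are eventually constant in each [obj i]. *)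
Lemma quasi_regular r (T : {ffun 'I_r -> A} -> {ffun 'I_r -> A}) y : linear T ->
  (forall i (x x' : {ffun 'I_r -> A}), (forall j, pi i (x j) = pi i (x' j)) ->
     forall j, pi i (T x j) = pi i (T x' j)) ->
  (forall n (x : {ffun 'I_r -> A}), (0 < n)%N -> (forall j, npow n (x j)) ->
     forall j, npow n.+1 (T x j)) ->
  exists x, x - T x = y.
Proof.
move=> TL Tpi Tnpow; have [_ _ TB _] := linear_facts TL.
pose X n := iter n (fun x => y + T x) 0.
(* Consecutive differences are iterates of [T] on the first one, and each application raises the
   degree by one. *)
have Xnpow n j : npow n.+1 ((X n.+1 - X n) j).
  elim: n j => [//|n IH] j.
  have -> : X n.+2 - X n.+1 = T (X n.+1 - X n).
    by rewrite /X !iterS TB opprD addrACA subrr add0r.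
  exact: Tnpow.
have piL i : linear (pi i) by case: A_lim => /(_ i)[].
have [N NP] := choice pi_nilp.
have Xstable i n j : (N i <= n)%N -> pi i (X n j) = pi i (X (N i) j).
  move=> /subnK <-; elim: (n - N i)%N => [//|m <-]; rewrite addSn.
  apply/eqP; rewrite -subr_eq0; apply/eqP.
  have [_ _ <- _] := linear_facts (piL i); apply: NP.
  have := Xnpow (m + N i)%N j; rewrite !ffunE.
  by apply: npow_antitone; rewrite /= ltnS leq_addl.
have /choice[x xP] j : exists a, forall i, pi i a = pi i (X (N i) j).
  apply: (inverse_limit_complete A_lim) => i i'; exists (X (maxn (N i) (N i')) j).
  by rewrite !Xstable ?leq_maxl ?leq_maxr.
exists [ffun j => x j]; apply/eqP; rewrite subr_eq; apply/eqP/ffunP => j.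
apply: (projection_inj A_lim) => i; have [_ piD _ _] := linear_facts (piL i).
rewrite !ffunE xP -(Xstable i (N i).+1 j (leqnSn _)) /X iterS !ffunE !piD.
by congr (_ + _); apply: Tpi => j'; rewrite ffunE xP.
Qed.

(* If [J], the stable value of [f (npow n)], is spanned by the [f (c j)], then
   [c] is congruent modulo [ker f] to [T c] for an operator [T] on [A^r] built
   from multiplications, such that [id - T] is surjective. *)
Lemma finite_dim_image_nilpotent (B : naAlgType k) (f : A -> B) :
  finite_dim B -> alg_hom f -> exists n, forall x, npow n.+1 x -> f x = 0.
Proof.
move=> [m [[g gL gB]]] [fL fM]; have g_inj := bij_inj gB.
pose h x := g (f x).
have hL : linear h by move=> a x y; rewrite /h fL gL.
have [h0 hD hB hZ] := linear_facts hL; have [g0 _ gB' _] := linear_facts gL.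
have h_f x : h x = 0 -> f x = 0 by rewrite /h -g0 => /g_inj.
have f_h x : f x = 0 -> h x = 0 by rewrite /h => ->.
have hMl x y : h y = 0 -> h (x ** y) = 0.
  move=> /h_f fy; apply: f_h; rewrite fM fy.
  by have [] := linear_facts (linear_namulr (f x)).
have hMr x y : h y = 0 -> h (y ** x) = 0.
  move=> /h_f fy; apply: f_h; rewrite fM fy.
  by have [] := linear_facts (linear_namull (f x)).
pose J n : set 'rV[k]_m := h @` npow n.+1.
have sJ n : submodule (J n).
  exact: (submodule_image hL (submodule_npow _ _)).
have [|n _ min_n] := submodule_dcc (P := setT) (U := J) _ (fun n _ => sJ n).
  by exists 0.
have [r [b bP]] := submodule_basis (sJ n).
have /choice[c cP] j : exists x, npow n.+1 x /\ h x = b j.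
  have /bP : exists a, b j = \sum_l a l *: b l; last by move=> [x ? ?]; exists x.
  exists (fun l => (l == j)%:R); rewrite (bigD1 j)//= eqxx scale1r.
  by rewrite big1 ?addr0// => l /negPf ->; rewrite scale0r.
have spanc x : npow n.+1 x -> exists a : 'I_r -> k, h x = h (\sum_l a l *: c l).
  move=> nx; have /bP[a ->] : J n (h x) by exists x.
  exists a; rewrite (big_morph h hD h0); apply: eq_bigr => l _.
  by rewrite hZ (cP l).2.
(* In a product of total degree [2n + 2] one factor has degree at least [n + 1], hence is a
   combination of the [c l] modulo [ker f]; the scalars go into the other factor. *)
have step x : npow (n.+1 + n.+1) x -> exists u : 'I_r -> A, exists v : 'I_r -> A,
    h x = h (\sum_l (u l ** c l + c l ** v l)).
  move: x; rewrite addSn; apply: npow_succ_sub => [|/=|].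
  - by rewrite addnS.
  - split; first exists (fun=> 0), (fun=> 0).
      rewrite h0 (big_morph h hD h0) big1// => l _.
      have [-> _ _ _] := linear_facts (linear_namull (c l)).
      by have [-> _ _ _] := linear_facts (linear_namulr (c l)); rewrite addr0.
    move=> a x y [u [v xE]] [u' [v' yE]].
    exists (fun l => a *: u l + u' l), (fun l => a *: v l + v' l).
    rewrite hL xE yE -hL scaler_sumr -big_split/=; congr h.
    apply: eq_bigr => l _; rewrite linear_namulr (linear_namull (c l)).
    by rewrite scalerDr addrACA.
  - move=> p q x y p0 q0 pq px qy.
    have [np|pn] := leqP n.+1 p.
      have [a xE] : exists a : 'I_r -> k, h x = h (\sum_l a l *: c l).
        by apply: spanc; apply: npow_antitone px.
      exists (fun=> 0), (fun l => a l *: y).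
      apply/eqP; rewrite -subr_eq0 -hB; apply/eqP.
      have -> : \sum_l (0 ** c l + c l ** (a l *: y)) = (\sum_l a l *: c l) ** y.
        have [y0 yD _ yZ] := linear_facts (linear_namull y).
        rewrite (big_morph (namul^~ y) yD y0); apply: eq_bigr => l _.
        have [-> _ _ _] := linear_facts (linear_namull (c l)).
        have [_ _ _ ->] := linear_facts (linear_namulr (c l)).
        by rewrite yZ add0r.
      have [_ _ <- _] := linear_facts (linear_namull y).
      by apply: hMr; rewrite hB xE subrr.
    have [a yE] : exists a : 'I_r -> k, h y = h (\sum_l a l *: c l).
      apply: spanc; apply: npow_antitone qy; rewrite /= -(leq_add2l p) pq.
      by rewrite -addSn leq_add2r ltnW.
    exists (fun l => a l *: x), (fun=> 0).
    apply/eqP; rewrite -subr_eq0 -hB; apply/eqP.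
    have -> : \sum_l (a l *: x ** c l + c l ** 0) = x ** (\sum_l a l *: c l).
      have [x0 xD _ xZ] := linear_facts (linear_namulr x).
      rewrite (big_morph (namul x) xD x0); apply: eq_bigr => l _.
      have [-> _ _ _] := linear_facts (linear_namulr (c l)).
      have [_ _ _ ->] := linear_facts (linear_namull (c l)).
      by rewrite xZ addr0.
    have [_ _ <- _] := linear_facts (linear_namulr x).
    by apply: hMl; rewrite hB yE subrr.
(* Minimality of [J n] allows [c j] to be replaced, modulo [ker f], by an element of degree
   [2n + 2]. *)
have Tc j : exists uv : ('I_r -> A) * ('I_r -> A),
    h (c j) = h (\sum_l (uv.1 l ** c l + c l ** uv.2 l)).
  have /min_n : J (n + n.+1)%N `<=` J n.
    apply: image_subset; apply: npow_antitone; by rewrite /= ltnS leq_addr.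
  move=> /(_ I (h (c j))) [|z nz <-]; first by exists (c j) => //; case: (cP j).
  by have [u [v zE]] := step z nz; exists (u, v).
have [uv uvP] := choice Tc.
pose T (x : {ffun 'I_r -> A}) : {ffun 'I_r -> A} :=
  [ffun j => \sum_l ((uv j).1 l ** x l + x l ** (uv j).2 l)].
have TL : linear T.
  move=> a x y; apply/ffunP => j; rewrite !ffunE scaler_sumr -big_split/=.
  apply: eq_bigr => l _; rewrite !ffunE linear_namulr (linear_namull _ a).
  by rewrite scalerDr addrACA.
(* Stated for any homomorphism [p], as it serves both for the projections and for [f]. *)
have Tker (C : naAlgType k) (p : A -> C) (x : {ffun 'I_r -> A}) :
    alg_hom p -> (forall j, p (x j) = 0) -> forall j, p (T x j) = 0.
  move=> [pL pM] px j; have [p0 pD _ _] := linear_facts pL.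
  rewrite ffunE (big_morph p pD p0) big1// => l _; rewrite pD !pM px.
  have [-> _ _ _] := linear_facts (linear_namulr (p ((uv j).1 l))).
  have [-> _ _ _] := linear_facts (linear_namull (p ((uv j).2 l))).
  by rewrite addr0.
have [T0 TD TB TZ] := linear_facts TL.
pose phi (x : {ffun 'I_r -> A}) : 'M[k]_(r, m) := \matrix_j h (x j).
have phiP x : phi x = 0 <-> forall j, h (x j) = 0.
  split=> [/row_matrixP + j|hx]; first by move/(_ j); rewrite rowK row0.
  by apply/row_matrixP => j; rewrite rowK row0.
have phiL : linear phi.
  move=> a x y; apply/row_matrixP => j; rewrite linearP /= !rowK !ffunE.
  exact: hL.
have := @surjective_hopfian _ _ _ phi (fun x => x - T x) phiL.
move=> /(_ _ _ _ [ffun j => c j]) hopf.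
have /phiP hc : phi [ffun j => c j] = 0.
  apply: hopf.
  - move=> a x y; rewrite TL scalerBr opprD addrACA //.
  - move=> y; apply: quasi_regular => //.
      move=> i x x' xx' j; have piH : alg_hom (pi i) by case: A_lim.
      have [_ _ piB _] := linear_facts piH.1.
      apply/eqP; rewrite -subr_eq0 -piB; apply/eqP.
      have := Tker _ _ (x - x') piH; rewrite TB => /(_ _ j).
      rewrite !ffunE; apply => l.
      by rewrite !ffunE piB xx' subrr.
    move=> q x q0 qx j; rewrite ffunE; apply: submodule_sum => [|l _].
      exact: submodule_npow.
    apply: submoduleD; first exact: submodule_npow.
      by rewrite -[q.+1]add1n; apply: npow_mul.
    by rewrite -[q.+1]addn1; apply: npow_mul.
  - move=> x /phiP hx; apply/phiP => j; rewrite !ffunE hB hx sub0r.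
    rewrite f_h ?oppr0//; have := Tker _ f x (conj fL fM) _ j; rewrite ffunE.
    by apply => l; apply: h_f.
  - apply/phiP => j; rewrite !ffunE hB (uvP j) -hB -[RHS]h0; congr h.
    apply/eqP; rewrite subr_eq0; apply/eqP/eq_bigr => l _.
    by rewrite ffunE.
exists n => x /spanc[a hx]; apply: h_f.
rewrite hx (big_morph h hD h0) big1// => l _.
by have := hc l; rewrite ffunE hZ => ->; rewrite scaler0.
Qed.

End FiniteDimensionalImages.

Theorem theorem11 (k : fieldType) (V : set (naAlgType k))
  (V_variety : is_variety V) (V_separative : separative V)
  (A : naAlgType k) (A_in_V : V A)
  (D : inv_system k) (D_findim : forall i : ix D, finite_dim (obj i))
  (pi : forall i : ix D, A -> obj i) (A_lim : is_inverse_limit pi)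
  (S : set A) (S_subalg : is_subalgebra S) (S_fg : finitely_generated S)
  (S_dense : dense (S : set (inverse_limit_topology pi))) :
  [/\ forall n : nat, (0 < n)%N ->
        open (npow n : set (inverse_limit_topology pi)),
      forall (B : naAlgType k) (f : A -> B), nilpotent_alg B -> alg_hom f ->
        continuous (f : inverse_limit_topology pi -> discrete_topology B)
    & (forall i : ix D, nilpotent_alg (obj i)) ->
      forall (B : naAlgType k) (f : A -> B), finite_dim B -> alg_hom f ->
        continuous (f : inverse_limit_topology pi -> discrete_topology B)].
Proof.
have ker_npow := npow_contains_ker V_separative A_in_V D_findim A_lim S_fg S_dense.
have piB i : {morph pi i : x y / x - y}.
  by case: A_lim => /(_ i)[piL _] _; have [] := linear_facts piL.
(* Once [f] kills [npow n.+1] it is constant on the fibers of some projection, so all preimages are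
   open. *)
have cont (B : naAlgType k) (f : A -> B) n : alg_hom f ->
    (forall x, npow n.+1 x -> f x = 0) ->
    continuous (f : inverse_limit_topology pi -> discrete_topology B).
  move=> [fL _] fn; have [_ _ fB _] := linear_facts fL.
  apply/continuousP => U _; apply: open_projection_saturated => x Ux.
  have [i in_npow] := ker_npow n; exists i => y yx; rewrite /preimage /=.
  suff -> : f y = f x by [].
  apply/eqP; rewrite -subr_eq0 -fB; apply/eqP/fn/in_npow.
  by rewrite piB yx subrr.
have hom_nilp (B : naAlgType k) (f : A -> B) : nilpotent_alg B -> alg_hom f ->
    exists n, forall x, npow n.+1 x -> f x = 0.
  move=> [[|n]// _ Bn] fhom; exists n => x /(npow_hom fhom (ltn0Sn n)).
  by rewrite Bn.
split=> [[|n]// _|B f Bnilp fhom|nilp B f Bfin fhom].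
- apply: open_projection_saturated => x nx; have [i in_npow] := ker_npow n.
  exists i => y yx; rewrite -(subrK x y).
  apply: submoduleD nx; first exact: submodule_npow.
  by apply: in_npow; rewrite piB yx subrr.
- by have [n fn] := hom_nilp B f Bnilp fhom; apply: cont fhom fn.
- have pi_nilp i : exists n, forall x, npow n.+1 x -> pi i x = 0.
    by apply: hom_nilp => //; case: A_lim.
  have [n fn] := finite_dim_image_nilpotent A_lim pi_nilp Bfin fhom.
  exact: cont fhom fn.
Qed.
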